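(* Let $R$ be a commutative ring with unity. Consider the two zero-divisor graphs $G:=\Gamma(\sigma(\operatorname{Spec} R))$ and $H:= \Gamma(\sigma(\operatorname{Alex} R))$. (1) $\chi(G) = \chi(H) = \operatorname{clique} G = \operatorname{clique} H = |\Omega(R)|$. (2) If $R$ is local (i.e. has only one maximal ideal), then $G = H = \emptyset$. (3) Suppose $R$ has exactly two maximal ideals $\mathfrak{m}_1, \mathfrak{m}_2$. If all nonmaximal prime ideals are contained in $\mathfrak{m}_1 \cap \mathfrak{m}_2$, then $\operatorname{diam} G = \operatorname{diam} H = 1$; otherwise $\operatorname{diam} G = \operatorname{diam} H = 2$. Moreover, if there exist $\mathfrak{p}_1, \mathfrak{p}_2 \in \operatorname{Spec} R \setminus \Omega(R)$ such that $\mathfrak{p}_i \subseteq \mathfrak{m}_i$ for $i=1,2$ but $\mathfrak{p}_1 \nsubseteq \mathfrak{m}_2$ and $\mathfrak{p}_2 \nsubseteq \mathfrak{m}_1$, then $\operatorname{girth} G = \operatorname{girth} H = 4$; otherwise $\operatorname{girth} G = \operatorname{girth} H = \infty$. (4) If $|\Omega(R)| \geq 3$, then $\operatorname{diam} H = \operatorname{girth} H = \operatorname{girth} G = 3$. (5) If $|\Omega(R)| \geq 3$ and $\operatorname{Jac} R$ is prime, then $\operatorname{diam} G = 2$. (6) If $|\Omega(R)| \geq 3$ and $\operatorname{Jac} R$ is not prime, then $\operatorname{diam} G = 3$.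
   Context: $\operatorname{Spec} R$ is the prime spectrum with the Zariski topology. $\operatorname{Alex} R$ is the same set of prime ideals with the topology whose closed sets are the sets of the form $\bigcup_{\lambda\in\Lambda} V(I_\lambda)$, where $\{I_\lambda \mid \lambda\in\Lambda\}$ is an arbitrary set of ideals of $R$ and $V(I)$ is the set of primes containing $I$. $\Omega(R)$ is the set of maximal ideals of $R$, and $\operatorname{Jac} R$ is the intersection of all maximal ideals of $R$. For a topological space $X$, $\sigma(X)$ is its lattice of closed subsets, regarded as a semigroup under $\cap$ with absorbing element $\emptyset$. $\Gamma(\sigma(X))$ is its zero-divisor graph: the vertices are the nonempty closed sets $A$ such that $A\cap B=\emptyset$ for some nonempty closed set $B$, and two distinct vertices $A,B$ are adjacent precisely when $A\cap B=\emptyset$. For a graph $G$: $\operatorname{diam} G$ is the supremum of the distances between pairs of vertices; $\operatorname{girth} G$ is the length of a shortest cycle, or $\infty$ if there are no cycles; $\operatorname{clique} G$ is the supremum of the cardinalities of sets of vertices on which the induced subgraph is complete; $\chi(G)$ is the infimum of the cardinalities of sets $A$ for which there is a map from the vertices of $G$ to $A$ taking different values on adjacent vertices.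
   Formalization: Part (1) is stated only for rings R that are not local: for a local ring both graphs are empty by (2), so the chromatic and clique numbers are 0 while |Ω(R)| = 1, and (1) as written fails. *)

(* Defs.v *)
From HB Require Import structures.
From mathcomp Require Import all_boot all_order all_algebra.
From mathcomp Require Import all_classical topology_structure.

Set Implicit Arguments.
Unset Strict Implicit.
Unset Printing Implicit Defensive.

Import GRing.Theory.

Local Open Scope classical_set_scope.
Local Open Scope ring_scope.
Local Open Scope card_scope.

(* Rings are [comPzRingType], so that the zero ring is included. The library's
   [idealr] and [prime_idealr] require a nonzero ring and only describe proper
   ideals, whereas here the unit ideal is needed to get [set0] = V(R). *)

Section Ideals.
Variable R : comPzRingType.

Definition is_ideal (I : set R) : Prop :=
  [/\ I 0, forall x y, I x -> I y -> I (x + y) & forall a x, I x -> I (a * x)].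

Definition is_prime_ideal (P : set R) : Prop :=
  [/\ is_ideal P, P != setT & forall x y, P (x * y) -> P x \/ P y].

Definition is_maximal_ideal (M : set R) : Prop :=
  [/\ is_ideal M, M != setT &
      forall J : set R, is_ideal J -> M `<=` J -> J = M \/ J = setT].

Definition ideal_gen (S : set R) : set R :=
  \bigcap_(I in [set I | is_ideal I /\ S `<=` I]) I.

Lemma bigcap_ideal (L : set (set R)) :
  (forall I, L I -> is_ideal I) -> is_ideal (\bigcap_(I in L) I).
Proof.
move=> Lid; split=> [I /Lid[]//|x y hx hy I LI|a x hx I LI].
- by have [_ + _] := Lid _ LI; apply; [apply: hx|apply: hy].
- by have [_ _] := Lid _ LI; apply; apply: hx.
Qed.

Lemma ideal_gen_ideal (S : set R) : is_ideal (ideal_gen S).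
Proof. by apply: bigcap_ideal => I []. Qed.

Lemma setT_ideal : is_ideal [set: R]. Proof. by []. Qed.

Lemma setI_ideal (I J : set R) : is_ideal I -> is_ideal J -> is_ideal (I `&` J).
Proof.
move=> [I0 ID IM] [J0 JD JM]; split=> //.
- by move=> x y [Ix Jx] [Iy Jy]; split; [apply: ID|apply: JD].
- by move=> a x [Ix Jx]; split; [apply: IM|apply: JM].
Qed.

End Ideals.

Definition Omega (R : comPzRingType) : set (set R) := [set M | is_maximal_ideal M].
Arguments Omega : clear implicits.

Definition Jac (R : comPzRingType) : set R := \bigcap_(M in Omega R) M.
Arguments Jac : clear implicits.

Definition is_local (R : comPzRingType) : Prop := exists M, Omega R = [set M].

Record primeIdeal (R : comPzRingType) := PrimeIdeal {
  prime_set :> set R;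
  primeP : is_prime_ideal prime_set }.

(* [Spec R] and [Alex R] are copies of the same type that carry different
   topologies. *)
Definition Spec (R : comPzRingType) : Type := primeIdeal R.
Definition Alex (R : comPzRingType) : Type := primeIdeal R.

Definition V (R : comPzRingType) (I : set R) : set (primeIdeal R) :=
  [set P | I `<=` P].

Definition spec_closed (R : comPzRingType) (A : set (Spec R)) : Prop :=
  exists2 I : set R, is_ideal I & A = V I.

Definition alex_closed (R : comPzRingType) (A : set (Alex R)) : Prop :=
  exists2 L : set (set R), (forall I, L I -> is_ideal I) & A = \bigcup_(I in L) V I.

Section Topologies.
Variable R : comPzRingType.
Implicit Types P : primeIdeal R.

Lemma prime_ideal P : is_ideal P. Proof. by case: (primeP P). Qed.

Lemma primeM P (x y : R) : prime_set P (x * y) -> prime_set P x \/ prime_set P y.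
Proof. by have [_ _] := primeP P; apply. Qed.

Lemma prime_proper P : ~ [set: R] `<=` P.
Proof. by have [_ /eqP PT _] := primeP P => TP; apply: PT; apply/seteqP. Qed.

Lemma V_setT : V [set: R] = set0.
Proof. by apply/seteqP; split=> P //= /prime_proper. Qed.

Lemma V_ideal_gen (S : set R) : V (ideal_gen S) = [set P | S `<=` P].
Proof.
apply/seteqP; split=> P /=.
- by move=> SP x Sx; apply: SP => I [_]; apply.
- by move=> SP x; apply; split=> //; exact: prime_ideal.
Qed.

Lemma V_setI (I J : set R) :
  is_ideal I -> is_ideal J -> V (I `&` J) = V I `|` V J.
Proof.
move=> [_ _ IM] [_ _ JM]; apply/seteqP; split=> P /=; last first.
  by move=> [IP x [/IP]//|JP x [_ /JP]].
move=> IJP; have [|/existsNP[x /not_implyP[Ix nPx]]] := pselect (I `<=` P).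
  by left.
right=> y Jy; have /IJP/primeM[//|//] : (I `&` J) (x * y).
by split; [rewrite mulrC; apply: IM|apply: JM].
Qed.

Lemma alex_closedP (A : set (Alex R)) :
  alex_closed A <-> forall P Q : Alex R, A P -> P `<=` Q -> A Q.
Proof.
split=> [[L _ ->] P Q [I LI IP] PQ|Aup].
  by exists I => //; apply: subset_trans PQ.
exists [set I | exists2 P, A P & I = prime_set P].
  by move=> _ [P _ ->]; exact: prime_ideal.
apply/seteqP; split=> P /=; first by exists (prime_set P) => //; exists P.
by move=> [_ [Q AQ ->]]; exact: Aup.
Qed.

Let spec_open (U : set (Spec R)) : Prop := spec_closed (~` U).

Let spec_openT : spec_open setT.
Proof. by exists setT => //; rewrite setCT V_setT. Qed.

Let spec_openI : setI_closed spec_open.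
Proof.
move=> A B [I hI AI] [J hJ BJ]; exists (I `&` J); first exact: setI_ideal.
by rewrite V_setI// setCI AI BJ.
Qed.

Let spec_open_bigU (T : Type) (f : T -> set (Spec R)) :
  (forall i, spec_open (f i)) -> spec_open (\bigcup_i f i).
Proof.
move=> fo; pose L := [set I : set R | exists i, ~` f i = V I].
exists (ideal_gen (\bigcup_(I in L) I)); first exact: ideal_gen_ideal.
rewrite V_ideal_gen setC_bigcup; apply/seteqP; split=> P /=.
- move=> fP x [I [i fI] Ix].
  by have := fP i Logic.I; rewrite fI; apply.
- by move=> LP i _; have [I hI fI] := fo i; rewrite fI => x Ix;
    apply: LP; exists I => //; exists i.
Qed.

Let alex_open (U : set (Alex R)) : Prop := alex_closed (~` U).

Let alex_openT : alex_open setT.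
Proof. by apply/alex_closedP; rewrite setCT. Qed.

Let alex_openI : setI_closed alex_open.
Proof.
move=> A B /alex_closedP hA /alex_closedP hB; apply/alex_closedP => P Q.
by rewrite setCI => -[nP|nP] PQ; [left; apply: hA PQ|right; apply: hB PQ].
Qed.

Let alex_open_bigU (T : Type) (f : T -> set (Alex R)) :
  (forall i, alex_open (f i)) -> alex_open (\bigcup_i f i).
Proof.
move=> fo; apply/alex_closedP => P Q; rewrite setC_bigcup => fP PQ i _.
by have /alex_closedP := fo i; apply; [exact: fP|exact: PQ].
Qed.

HB.instance Definition _ := gen_eqMixin (Spec R).
HB.instance Definition _ := gen_choiceMixin (Spec R).
HB.instance Definition _ := @isOpenTopological.Build (Spec R)
  spec_open spec_openT spec_openI spec_open_bigU.

HB.instance Definition _ := gen_eqMixin (Alex R).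
HB.instance Definition _ := gen_choiceMixin (Alex R).
HB.instance Definition _ := @isOpenTopological.Build (Alex R)
  alex_open alex_openT alex_openI alex_open_bigU.

Lemma closed_SpecE (A : set (Spec R)) : closed A <-> spec_closed A.
Proof. by rewrite -openC /open /= /spec_open setCK. Qed.

Lemma closed_AlexE (A : set (Alex R)) : closed A <-> alex_closed A.
Proof. by rewrite -openC /open /= /alex_open setCK. Qed.

End Topologies.

Record graph := Graph {
  vertex :> choiceType;
  edge : rel vertex;
  edge_sym : symmetric edge;
  edge_irr : irreflexive edge }.

Section ZeroDivisorGraph.
Variable X : topologicalType.

Definition zd_vertex : set (set X) :=
  [set A | [/\ closed A, A !=set0 &
    exists B, [/\ closed B, B !=set0 & A `&` B = set0]]].

Definition zd_edge : rel zd_vertex :=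
  fun A B => (A != B) && (val A `&` val B == set0).

Lemma zd_edge_sym : symmetric zd_edge.
Proof. by move=> A B; rewrite /zd_edge eq_sym setIC. Qed.

Lemma zd_edge_irr : irreflexive zd_edge.
Proof. by move=> A; rewrite /zd_edge eqxx. Qed.

Definition Gamma_sigma : graph := Graph zd_edge_sym zd_edge_irr.

End ZeroDivisorGraph.

(* [enat] is the set of natural numbers together with infinity, encoded as
   [None]. The supremum of the empty set is 0. *)
Definition enat := option nat.

Definition enat_le (x y : enat) : bool :=
  match x, y with
  | _, None => true
  | None, Some _ => false
  | Some m, Some n => (m <= n)%N
  end.

Definition enat_inf (S : set nat) : enat :=
  match pselect (exists n, `[< S n >]) with
  | left exS => Some (ex_minn exS)
  | right _ => None
  end.

Definition enat_sup (S : set enat) : enat :=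
  enat_inf [set n | forall x, S x -> enat_le x (Some n)].

Section GraphInvariants.
Variable G : graph.

Definition dist (u v : G) : enat :=
  enat_inf [set n | exists p : seq G,
    [/\ path (@edge G) u p, last u p = v & size p = n]].

Definition diam : enat := enat_sup [set d | exists u v : G, d = dist u v].

Definition girth : enat :=
  enat_inf [set n | exists c : seq G,
    [/\ ucycle (@edge G) c, (2 < size c)%N & size c = n]].

Definition is_clique (K : set G) : Prop :=
  forall u v, K u -> K v -> u != v -> edge u v.

Definition colorable U (A : set U) : Prop :=
  exists2 c : G -> U, (forall u, A (c u)) & forall u v, edge u v -> c u <> c v.

(* There is no type of cardinals: "clique G = |S|" and "chi(G) = |S|" are
   expressed by saying that |S| is the relevant least upper bound, respectively
   greatest lower bound, for the comparison [#<=] of cardinalities. *)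
Definition clique_number_is U (S : set U) : Prop :=
  (forall K, is_clique K -> K #<= S) /\
  (forall (W : Type) (T : set W), (forall K, is_clique K -> K #<= T) -> S #<= T).

Definition chromatic_number_is U (S : set U) : Prop :=
  (forall (W : Type) (A : set W), colorable A -> S #<= A) /\
  (forall (W : Type) (T : set W),
     (forall (W' : Type) (A : set W'), colorable A -> T #<= A) -> T #<= S).

End GraphInvariants.

(* Main.v *)
Require Import Defs.
From mathcomp Require Import all_boot all_order all_algebra.
From mathcomp Require Import all_classical topology_structure.

Set Implicit Arguments.
Unset Strict Implicit.
Unset Printing Implicit Defensive.

Local Open Scope classical_set_scope.
Local Open Scope card_scope.

(** Both graphs are governed by the closed points of the space. In [Spec R]
    and in [Alex R] the closure of a prime [P] is the set of primes containing
    [P], so the closed points are the maximal ideals, and by Zorn's lemma every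
    nonempty closed set contains one. For any space [X] with that property,

    - disjointness of closed sets can be tested on closed points ([edgeP]), and
      the vertices of the zero-divisor graph are the nonempty closed sets that
      miss some closed point;
    - choosing a closed point in each vertex is a proper colouring, while the
      closed singletons form a clique; as a colouring is injective on a clique,
      the chromatic number and the clique number both equal the number of
      closed points ([chromatic_clique_numbers]);
    - with a single closed point nothing misses it, so there are no vertices;
    - with two closed points [x] and [y] each vertex contains exactly one of
      them, so the graph is complete bipartite. Its diameter and girth depend
      only on which side has more than one vertex, and the side of [x] does iff
      some nonclosed point specializes to [x] but not to [y]
      ([multiple_vertices]);
    - with three closed points the closed singletons form triangles. All
      distances are at most 3, and two vertices that miss a common closed point
      have the corresponding singleton as a common neighbour. So distance 3
      occurs iff two closed sets can cover the set of closed points without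
      either doing so alone, that is, iff this set is reducible.

    Only this last criterion distinguishes the two topologies. In [Alex R]
    every set of maximal ideals is closed, so the maximal ideals form a
    reducible set as soon as there are two of them
    ([Alex_closed_points_reducible]). In [Spec R] their irreducibility says that
    the Jacobson radical is prime ([Spec_irreducible_Jac]). *)

(** * Extended natural numbers *)

Lemma enat_le_anti (x y : enat) : enat_le x y -> enat_le y x -> x = y.
Proof.
case: x y => [m|] [n|] //= mn nm; congr Some.
by apply/anti_leq; rewrite mn nm.
Qed.

Lemma enat_le_trans (y x z : enat) :
  enat_le x y -> enat_le y z -> enat_le x z.
Proof. by case: x y z => [m|] [n|] [p|] //=; apply: leq_trans. Qed.

Lemma enat_inf_le (S : set nat) n : S n -> enat_le (enat_inf S) (Some n).
Proof.
move=> Sn; rewrite /enat_inf; case: pselect => [exS|[]]; last first.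
  by exists n; apply/asboolP.
by case: ex_minnP => m _ /=; apply; apply/asboolP.
Qed.

Lemma le_enat_inf (S : set nat) n :
  (forall m, S m -> n <= m) -> enat_le (Some n) (enat_inf S).
Proof.
move=> Sge; rewrite /enat_inf; case: pselect => [exS|//].
by case: ex_minnP => m Sm _ /=; apply/Sge/asboolP.
Qed.

Lemma enat_inf_infty (S : set nat) : S = set0 -> enat_inf S = None.
Proof.
move=> ->; rewrite /enat_inf; case: pselect => // exS.
by have [n /asboolP] := exS.
Qed.

(** * Distance, diameter and girth *)

Section Graphs.
Variable G : graph.
Implicit Types u v w : G.

Lemma dist_path_le u (p : seq G) :
  path (@edge G) u p -> enat_le (dist u (last u p)) (Some (size p)).
Proof. by move=> up; apply: enat_inf_le; exists p. Qed.

Lemma dist_le0 u : enat_le (dist u u) (Some 0).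
Proof. exact: (@dist_path_le u [::]). Qed.

Lemma dist_le1 u v : edge u v -> enat_le (dist u v) (Some 1).
Proof. by move=> uv; apply: (@dist_path_le u [:: v]); rewrite /= uv. Qed.

Lemma dist_le2 w u v : edge u w -> edge w v -> enat_le (dist u v) (Some 2).
Proof.
by move=> uw wv; apply: (@dist_path_le u [:: w; v]); rewrite /= uw wv.
Qed.

Lemma dist_le3 w t u v :
  edge u w -> edge w t -> edge t v -> enat_le (dist u v) (Some 3).
Proof.
move=> uw wt tv; apply: (@dist_path_le u [:: w; t; v]).
by rewrite /= uw wt tv.
Qed.

Lemma dist_ge1 u v : u != v -> enat_le (Some 1) (dist u v).
Proof.
move=> uv; apply: le_enat_inf => n [[|a p] [_ /= uE <-]] //.
by rewrite uE eqxx in uv.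
Qed.

Lemma dist_ge2 u v : u != v -> ~~ edge u v -> enat_le (Some 2) (dist u v).
Proof.
move=> uv nuv; apply: le_enat_inf => n [[|a [|b p]] [/= + uE <-]] //.
  by rewrite uE eqxx in uv.
by rewrite uE (negPf nuv).
Qed.

Lemma dist_ge3 u v : u != v -> ~~ edge u v ->
  (forall w, edge u w -> ~~ edge w v) -> enat_le (Some 3) (dist u v).
Proof.
move=> uv nuv nuwv; apply: le_enat_inf => n [[|a [|b [|c p]]] [/= + uE <-]] //.
- by rewrite uE eqxx in uv.
- by rewrite uE (negPf nuv).
- by rewrite uE => /and3P[/nuwv/negPf->].
Qed.

Lemma diam_le n :
  (forall u v, enat_le (dist u v) (Some n)) -> enat_le (diam G) (Some n).
Proof. by move=> dn; apply: enat_inf_le => _ [u [v ->]]. Qed.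

Lemma le_diam u v n :
  enat_le (Some n) (dist u v) -> enat_le (Some n) (diam G).
Proof.
move=> nd; apply: le_enat_inf => m /(_ (dist u v)) /=.
have /[swap]/[apply] : exists u0 v0, dist u v = dist u0 v0 by exists u, v.
by case: dist nd => //= k; apply: leq_trans.
Qed.

Lemma diam_eq n u v : (forall u v, enat_le (dist u v) (Some n)) ->
  enat_le (Some n) (dist u v) -> diam G = Some n.
Proof. by move=> /diam_le dn /le_diam nd; apply: enat_le_anti. Qed.

Lemma girth_triangle u v w :
  edge u v -> edge v w -> edge w u -> girth G = Some 3.
Proof.
move=> uv vw wu; have irr x y : edge x y -> x != y :> G.
  by apply: contraTneq => ->; rewrite edge_irr.
apply: enat_le_anti; last by apply: le_enat_inf => n [c [_ + <-]].
apply: enat_inf_le; exists [:: u; v; w]; split => //.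
by rewrite /ucycle /= uv vw wu !inE negb_or !irr // edge_sym.
Qed.

(** ** Complete bipartite graphs *)

(** The two sides are the fibres of [side]; each diameter and girth below
    depends on whether a fibre has two distinct vertices. *)
Section CompleteBipartite.
Variable side : G -> bool.
Hypothesis edgeE : forall u v, edge u v = (side u != side v).

Let multiple b := exists u v, [/\ u != v, side u = b & side v = b].

Lemma complete_bipartite_diam1 : (exists u, side u) -> (exists u, ~~ side u) ->
  (forall b, ~ multiple b) -> diam G = Some 1.
Proof.
move=> [a sa] [b sb] single; apply: (@diam_eq _ a b); last first.
  by apply: dist_ge1; apply: contraNneq sb => <-.
move=> u v; have [suv|suv] := eqVneq (side u) (side v); last first.
  by apply: dist_le1; rewrite edgeE.
have [->|uv] := eqVneq u v; first exact: enat_le_trans (dist_le0 v) _.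
by case: (single (side v)); exists u, v.
Qed.

Lemma complete_bipartite_diam2 b :
  (exists u, side u) -> (exists u, ~~ side u) -> multiple b -> diam G = Some 2.
Proof.
move=> [a sa] [a' sa'] [c [d [cd sc sd]]]; apply: (@diam_eq _ c d); last first.
  by apply: dist_ge2; rewrite ?edgeE ?sc ?sd ?eqxx.
move=> u v; have [suv|suv] := eqVneq (side u) (side v); last first.
  by apply: (@enat_le_trans (Some 1)) => //; apply: dist_le1; rewrite edgeE.
have [w sw] : exists w, side w = ~~ side u.
  by case: (side u); [exists a'; apply/negbTE|exists a].
by apply: (@dist_le2 w); rewrite edgeE sw -?suv; case: side.
Qed.

(** Two vertices on each side span a 4-cycle, and a triangle would have two
    adjacent vertices on the same side. *)
Lemma complete_bipartite_girth4 : (forall b, multiple b) -> girth G = Some 4.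
Proof.
move=> mult; have [a [a' [aa' sa sa']]] := mult true.
have [b [b' [bb' sb sb']]] := mult false.
have ne x y : side x = true -> side y = false -> x != y :> G.
  by move=> sx sy; apply/eqP => xy; rewrite xy sy in sx.
apply: enat_le_anti.
  apply: enat_inf_le; exists [:: a; b; a'; b']; split => //.
  rewrite /ucycle /= !edgeE sa sb sa' sb' !inE !negb_or aa' bb' (eq_sym b a').
  by rewrite (ne a b) ?(ne a b') ?(ne a' b) ?(ne a' b').
apply: le_enat_inf => n [[|x [|y [|z [|t c]]]] [+ + <-]] //=.
rewrite /ucycle /= !edgeE.
by case: (side x); case: (side y); case: (side z); rewrite ?andbF.
Qed.

(** Such a graph is a star: a cycle visits the centre at most once, but one of
    any two consecutive vertices is the centre. *)
Lemma complete_bipartite_girth_infty b : ~ multiple b -> girth G = None.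
Proof.
move=> single; apply/enat_inf_infty/seteqP; split => // n.
have eqb x y : side x = b -> side y = b -> x = y.
  move=> sx sy; apply/eqP; apply: contra_notT single => xy.
  by exists x, y.
move=> [[|x [|y [|z c]]] [+ + _]] //= => /andP[/= + /andP[+ /andP[+ _]]] _.
rewrite !edgeE !inE !negb_or => + /andP[xy /andP[xz xc]] /andP[yz yc].
have flip (s t : bool) : s != t -> s = ~~ t by case: s; case: t.
(* If [y] is a leaf, its neighbours [x] and [z] are both the centre. *)
have [sy|/flip sy] := eqVneq (side y) b; last first.
  move=> /and3P[/flip sx syz _]; move: xz; rewrite eq_sym in syz.
  by rewrite (eqb x z) ?eqxx // ?sx ?(flip _ _ syz) sy negbK.
(* If [y] is the centre, [z] is a leaf: the cycle cannot close after [z], and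
   the vertex [t] after [z] would be the centre again. *)
case: c xc yc => [|t c] /=; rewrite ?edgeE ?inE ?negb_or.
  by move=> _ _; case: (side x) (side y) (side z) => [] [] [].
move=> _ /andP[yt _] /and4P[_]; rewrite eq_sym sy => /flip sz.
rewrite eq_sym sz => /flip; rewrite negbK => st.
by rewrite (eqb y t) ?eqxx in yt.
Qed.

End CompleteBipartite.

(** * Colourings and cliques *)

Lemma colorable_card_le U U' (A : set U) (B : set U') :
  colorable G A -> A #<= B -> colorable G B.
Proof.
move=> [c cA cE] /card_leP[f].
exists (fun u => val (f (SigSub (mem_set (cA u))))) => [u|u v uv].
  exact: set_valP.
move=> /val_inj /(inj (mem_setT _) (mem_setT _)) /(congr1 val) /=; exact: cE.
Qed.

Lemma clique_card_le_colorable U (A : set U) (K : set G) :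
  colorable G A -> is_clique K -> K #<= A.
Proof.
move=> [c cA cE] clK; apply: card_le_trans (_ : K #<= c @` K) _; last first.
  by apply: subset_card_le => _ [u _ <-].
have /card_eqPle[] // : c @` K #= K.
apply: inj_card_eq => u v /set_mem Ku /set_mem Kv cuv.
by apply/eqP; apply: contra_notT (cE u v ^~ cuv) => /(clK _ _ Ku Kv).
Qed.

(** A clique as large as a set of colours makes both optimal. *)
Lemma chromatic_clique_numbers U (S : set U) (K : set G) : colorable G S ->
  is_clique K -> S #<= K -> chromatic_number_is G S /\ clique_number_is G S.
Proof.
move=> colS clK SK; (split; split) => [W A colA|W T|L|W T].
- exact: card_le_trans SK (clique_card_le_colorable colA clK).
- exact.
- exact: clique_card_le_colorable.
- by move=> /(_ K clK); apply: card_le_trans.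
Qed.

End Graphs.

(** * The zero-divisor graph of a space with enough closed points *)

Definition closed_points (X : topologicalType) : set X :=
  [set x | closed [set x]].
Arguments closed_points : clear implicits.

Definition closed_points_irreducible (X : topologicalType) : Prop :=
  forall A B : set X, closed A -> closed B -> closed_points X `<=` A `|` B ->
    closed_points X `<=` A \/ closed_points X `<=` B.

Lemma closureS_closed (X : topologicalType) (A B : set X) :
  closed B -> A `<=` B -> closure A `<=` B.
Proof. by move=> clB AB; rewrite closureE => x; apply. Qed.

Section ClosedPoints.
Variable X : topologicalType.
Hypothesis closed_pointed : forall A : set X,
  closed A -> A !=set0 -> exists2 x, closed_points X x & A x.

Local Notation G := (Gamma_sigma X).

Definition vset (u : G) : set X := val u.

Lemma vset_inj : injective vset. Proof. exact: val_inj. Qed.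

Lemma vset_closed u : closed (vset u).
Proof. by case: (set_valP u). Qed.

Lemma vset_closed_point u : exists2 x, closed_points X x & vset u x.
Proof. by apply: closed_pointed; case: (set_valP u). Qed.

Lemma vset_missed_point u : exists2 x, closed_points X x & ~ vset u x.
Proof.
have [_ _ [B [clB /(closed_pointed clB)[x cx Bx] AB]]] := set_valP u.
by exists x => // ux; have : set0 x by rewrite -AB.
Qed.

(** The closed singleton of a missed closed point is the disjoint nonempty
    closed set that a vertex requires. *)
Lemma vertex_of A x y :
  closed A -> A x -> closed_points X y -> ~ A y -> exists u, vset u = A.
Proof.
move=> clA Ax cy nAy; have vA : zd_vertex A.
  split=> //; first by exists x.
  exists [set y]; split=> //; first by exists y.
  by apply/seteqP; split=> // z [/[swap]->].
by exists (SigSub (mem_set vA)).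
Qed.

Lemma vertex_of_point x y : closed_points X x -> closed_points X y ->
  x <> y -> exists u, vset u = [set x].
Proof. by move=> cx cy xy; apply: (@vertex_of _ x y) => // /esym. Qed.

(** A nonempty intersection of two closed sets is closed, so it contains a
    closed point. *)
Lemma edgeP (u v : G) :
  reflect (forall x, closed_points X x -> vset u x -> ~ vset v x) (edge u v).
Proof.
apply: (iffP andP) => [[_ /eqP uv] x _ ux vx|uv].
  by have : set0 x by rewrite -uv.
have uv0 : vset u `&` vset v = set0.
  apply: contrapT => /eqP/set0P /closed_pointed[|x cx [ux vx]].
    by apply: closedI; exact: vset_closed.
  exact: uv cx ux vx.
split; last exact/eqP.
have [x cx ux] := vset_closed_point u.
by apply/eqP => uv'; apply: (uv x) => //; rewrite -uv'.
Qed.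

Lemma edgePn (u v : G) :
  ~~ edge u v -> exists x, [/\ closed_points X x, vset u x & vset v x].
Proof.
move=> /negP nuv; apply: contrapT => nx; apply/nuv/edgeP => x cx ux vx.
by apply: nx; exists x.
Qed.

Lemma not_edge (u v : G) x :
  closed_points X x -> vset u x -> vset v x -> ~~ edge u v.
Proof. by move=> cx ux vx; apply/negP => /edgeP/(_ x); apply. Qed.

Lemma edge_of_missed_point (u : G) x y : closed_points X x ->
  closed_points X y -> ~ vset u x -> x <> y ->
  exists2 v, vset v = [set x] & edge u v.
Proof.
move=> cx cy nux xy; have [v vE] := vertex_of_point cx cy xy.
by exists v => //; apply/edgeP => z _ uz; rewrite vE => zx; rewrite -zx in nux.
Qed.

(** The singleton of a closed point missed by both vertices is adjacent to
    both. *)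
Lemma dist_le2_missed (u v : G) x : closed_points X x ->
  ~ vset u x -> ~ vset v x -> enat_le (dist u v) (Some 2).
Proof.
move=> cx nux nvx; have [y cy uy] := vset_closed_point u.
have xy : x <> y by move=> xy; rewrite xy in nux.
have [w wE uw] := edge_of_missed_point cx cy nux xy.
apply: dist_le2 uw _; rewrite edge_sym; apply/edgeP => z _ vz.
by rewrite wE => zx; rewrite -zx in nvx.
Qed.

(** ** Chromatic and clique number *)

Lemma colorable_closed_points : colorable G (closed_points X).
Proof.
pose c u : X := projT1 (cid2 (vset_closed_point u)).
have cP u : closed_points X (c u) /\ vset u (c u) by rewrite /c; case: cid2.
exists c => [u|u v /edgeP uv cuv]; first by case: (cP u).
by case: (cP u) => cc uc; apply: (uv _ cc uc); rewrite cuv; case: (cP v).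
Qed.

(** When the space has exactly one closed point, its singleton is not a vertex;
    otherwise each closed singleton is disjoint from another one. *)
Lemma closed_points_clique : ~ (exists x, closed_points X = [set x]) ->
  exists2 K : set G, is_clique K & closed_points X #<= K.
Proof.
move=> nsingle.
pose K := [set u : G | exists2 x, closed_points X x & vset u = [set x]].
have Kvertex x : closed_points X x -> exists u, vset u = [set x].
  move=> cx; apply: contrapT => nu; apply: nsingle; exists x.
  apply/seteqP; split=> [y cy|_ ->//]; apply: contrapT => /= yx.
  by apply: nu; apply: vertex_of_point cx cy _ => /esym.
exists K => [u v [x cx uE] [y cy vE] uv|].
  apply/edgeP => z _; rewrite uE vE /= => -> xy; move: uv; rewrite xy in uE.
  by rewrite -(inj_eq vset_inj) uE vE eqxx.
have /card_eqPle[_ le1] : set1 @` closed_points X #= closed_points X.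
  by apply: inj_card_eq => x y _ _ /seteqP[/(_ x erefl)].
apply: card_le_trans le1 _; apply: card_le_trans (card_image_le vset K).
apply: subset_card_le => _ [x cx <-].
by have [u uE] := Kvertex x cx; exists u => //; exists x.
Qed.

Lemma no_vertex x : closed_points X = [set x] -> [set: G] = set0.
Proof.
move=> cE; apply/seteqP; split=> // u _.
have [y + uy] := vset_closed_point u; have [z + nuz] := vset_missed_point u.
by rewrite cE => /= zE yE; apply: nuz; rewrite zE -yE.
Qed.

(** ** Two closed points *)

Section TwoClosedPoints.
Variables x y : X.
Hypotheses (xy : x <> y) (cE : closed_points X = [set x; y]).

Let cx : closed_points X x. Proof. by rewrite cE; left. Qed.
Let cy : closed_points X y. Proof. by rewrite cE; right. Qed.

(** By [sideNP], the other side consists of the vertices containing [y]. *)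
Definition side (u : G) : bool := `[< vset u x >].

Lemma sideP u : reflect (vset u x) (side u). Proof. exact: asboolP. Qed.

Lemma sideNP u : reflect (vset u y) (~~ side u).
Proof.
apply: (iffP idP) => [/sideP nux|uy].
  have [z + uz] := vset_closed_point u.
  by rewrite cE => -[]zE; rewrite zE in uz.
apply/sideP => ux; have [z + nuz] := vset_missed_point u.
by rewrite cE => -[]zE; rewrite zE in nuz.
Qed.

Lemma edge_side u v : edge u v = (side u != side v).
Proof.
apply/edgeP/idP => [uv|].
  apply/negP => /eqP suv; case: (boolP (side u)) => su.
    by apply: (uv x cx); apply/sideP; rewrite -?suv.
  by apply: (uv y cy); apply/sideNP; rewrite -?suv.
move=> suv z; rewrite cE => -[]-> /[dup].
  by move=> /sideP su _ /sideP sv; rewrite su sv in suv.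
by move=> /sideNP/negbTE su _ /sideNP/negbTE sv; rewrite su sv in suv.
Qed.

End TwoClosedPoints.

(** One vertex through [x] that avoids [y] is the closed singleton of [x]. Any
    other one contains a point [p] besides [x]; its closure lies in the vertex,
    so [x] is the only closed point there. Conversely the closure of such a [p]
    is a second vertex. *)
Lemma multiple_vertices (x y : X) : x <> y -> closed_points X = [set x; y] ->
  (exists u v : G, [/\ u != v, vset u x /\ ~ vset u y & vset v x /\ ~ vset v y])
  <-> exists p, [/\ ~ closed_points X p, closure [set p] x &
                   ~ closure [set p] y].
Proof.
move=> xy cE.
have cx : closed_points X x by rewrite cE; left.
have cy : closed_points X y by rewrite cE; right.
split=> [[u [v [uv uxy vxy]]]|[p [ncp px npy]]]; last first.
  have [v vE] := vertex_of_point cx cy xy.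
  have [u uE] := vertex_of (@closed_closure X [set p]) px cy npy.
  exists u, v; rewrite uE vE; split=> //; last by split => // /esym.
  apply/eqP => uv; have : vset v p by rewrite -uv uE; apply: subset_closure.
  by rewrite vE => /= pE; apply: ncp; rewrite pE.
have [w [wx nwy wne]] :
    exists w : G, [/\ vset w x, ~ vset w y & vset w <> [set x]].
  case: uxy vxy => ux nuy [vx nvy].
  have [uE|] := pselect (vset u = [set x]); last by exists u.
  exists v; split=> // vE; case/eqP: uv; apply: vset_inj.
  by rewrite uE vE.
have [p wp px] : exists2 p, vset w p & p <> x.
  apply: contrapT => np; apply: wne; apply/seteqP; split=> [p wp|_ ->//].
  by apply: contrapT => px; apply: np; exists p.
have pw : closure [set p] `<=` vset w.
  by apply: closureS_closed => [|_ ->//]; exact: vset_closed.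
have npy : ~ closure [set p] y by move=> /pw.
exists p; split=> //.
  by rewrite cE => -[]//= pE; rewrite pE in wp.
have [|z] := closed_pointed (@closed_closure X [set p]).
  by exists p; apply: subset_closure.
by rewrite cE => -[]->.
Qed.

Lemma two_closed_points_graph (x y : X) :
  x <> y -> closed_points X = [set x; y] ->
  let below := forall p : X, ~ closed_points X p ->
    closure [set p] x /\ closure [set p] y in
  let separated := exists p q : X,
    [/\ ~ closed_points X p /\ ~ closed_points X q,
        closure [set p] x, closure [set q] y,
        ~ closure [set p] y & ~ closure [set q] x] in
  [/\ below -> diam G = Some 1, ~ below -> diam G = Some 2,
      separated -> girth G = Some 4 & ~ separated -> girth G = None].
Proof.
move=> xy cE below separated.
have sE := edge_side cE; have sP := sideP x; have sNP := sideNP cE.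
pose single p a b := [/\ ~ closed_points X p, closure [set p] a &
  ~ closure [set p] b].
pose multiple b := exists u v, [/\ u != v, side x u = b & side x v = b].
have multT : multiple true <-> exists p, single p x y.
  rewrite -(multiple_vertices xy cE); split=> -[u [v [uv su sv]]].
    exists u, v; split=> //; split; try exact/sP.
      by apply/sNP; rewrite su.
    by apply/sNP; rewrite sv.
  by exists u, v; split=> //; apply/sP; [case: su|case: sv].
have multF : multiple false <-> exists p, single p y x.
  have yx : y <> x by move=> /esym.
  have cE' : closed_points X = [set y; x] by rewrite setUC.
  rewrite -(multiple_vertices yx cE'); split=> -[u [v [uv su sv]]].
    exists u, v; split=> //; split.
    - by apply/sNP; rewrite su.
    - by apply/sP; rewrite su.
    - by apply/sNP; rewrite sv.
    - by apply/sP; rewrite sv.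
  by exists u, v; split=> //; apply/negbTE/sNP; [case: su|case: sv].
have cx : closed_points X x by rewrite cE; left.
have cy : closed_points X y by rewrite cE; right.
have exT : exists u, side x u.
  by have [u uE] := vertex_of_point cx cy xy; exists u; apply/sP; rewrite uE.
have exF : exists u, ~~ side x u.
  have yx : y <> x by move=> /esym.
  by have [u uE] := vertex_of_point cy cx yx; exists u; apply/sNP; rewrite uE.
split.
- move=> bel; apply: complete_bipartite_diam1 sE exT exF _ => -[].
    by move=> /multT[p [/bel[_ +] _]].
  by move=> /multF[p [/bel[+ _] _]].
- move=> /existsNP[p /not_implyP[ncp npxy]].
  have [|z + pz] := closed_pointed (@closed_closure X [set p]).
    by exists p; apply: subset_closure.
  rewrite cE => -[]zE; rewrite {}zE in pz.
    apply: (complete_bipartite_diam2 sE exT exF); apply/multT.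
    by exists p; split=> // py; apply: npxy.
  apply: (complete_bipartite_diam2 sE exT exF); apply/multF.
  by exists p; split=> // px; apply: npxy.
- move=> [p [q [[ncp ncq] px qy npy nqx]]].
  apply: complete_bipartite_girth4 sE _ => -[].
    by apply/multT; exists p.
  by apply/multF; exists q.
- move=> nsep; have [mT|nmT] := pselect (multiple true); last first.
    exact (complete_bipartite_girth_infty sE nmT).
  apply: (complete_bipartite_girth_infty sE (b := false)).
  move=> /multF[q [ncq qy nqx]]; move/multT: mT => [p [ncp px npy]].
  by apply: nsep; exists p, q.
Qed.

(** ** Three or more closed points *)

(** Take a neighbour of each endpoint. If they are adjacent they complete a path
    of length 3; otherwise they share a closed point, which both endpoints
    miss. *)
Lemma dist_vertex_le3 (u v : G) : enat_le (dist u v) (Some 3).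
Proof.
have [->|uv] := eqVneq u v; first exact: enat_le_trans (dist_le0 v) _.
have nbr (w : G) : exists w', edge w w'.
  have [a ca wa] := vset_closed_point w; have [b cb nwb] := vset_missed_point w.
  have [|w' _] := edge_of_missed_point cb ca nwb; last by exists w'.
  by move=> ba; rewrite ba in nwb.
have [[u' uu'] [v' vv']] := (nbr u, nbr v).
have [u'v'|/edgePn[z [cz u'z v'z]]] := boolP (edge u' v').
  by apply: (dist_le3 uu' u'v'); rewrite edge_sym.
apply: (@enat_le_trans (Some 2)) => //; apply: (dist_le2_missed cz).
  by move=> uz; have /edgeP/(_ z cz uz) := uu'.
by move=> vz; have /edgeP/(_ z cz vz) := vv'.
Qed.

(** A common neighbour of two vertices that cover the closed points would
    contain no closed point. *)
Lemma covering_diam A B p q : closed A -> closed B ->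
  closed_points X `<=` A `|` B -> closed_points X p -> ~ A p ->
  closed_points X q -> ~ B q -> (exists2 t, closed_points X t & A t /\ B t) ->
  diam G = Some 3.
Proof.
move=> clA clB AB cp nAp cq nBq [t ct [At Bt]].
have [a aE] := vertex_of clA At cp nAp; have [b bE] := vertex_of clB Bt cq nBq.
apply: (@diam_eq _ _ a b) => [*|]; first exact: dist_vertex_le3.
apply: dist_ge3.
- apply/eqP => ab; have eqAB : A = B by rewrite -aE -bE ab.
  by have [] := AB p cp => [//|]; rewrite -eqAB.
- by apply: (not_edge ct); rewrite ?aE ?bE.
- move=> w /edgeP aw; apply/negP => /edgeP wb.
  have [s cs ws] := vset_closed_point w.
  have [As|Bs] := AB s cs; first by apply: (aw s) => //; rewrite aE.
  by apply: (wb s) => //; rewrite bE.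
Qed.

(** If [A] and [B] share no closed point they are adjacent and do not realize
    distance 3; enlarging [B] by a closed point of [A] makes them meet, and [B]
    still misses another closed point of [A]. *)
Lemma covering_diam_two_points A B s t q : closed A -> closed B ->
  closed_points X `<=` A `|` B ->
  closed_points X s -> A s -> closed_points X t -> A t -> s <> t ->
  closed_points X q -> ~ A q -> ~ closed_points X `<=` B ->
  diam G = Some 3.
Proof.
move=> clA clB AB cs As ct At st cq nAq nB.
have [[r [cr Ar Br]]|nAB] :=
    pselect (exists r, [/\ closed_points X r, A r & B r]).
  move/existsNP: nB => [p /not_implyP[cp nBp]].
  by apply: (covering_diam clA clB AB cq nAq cp nBp); exists r.
apply: (@covering_diam A (B `|` [set s]) q t) => //.
- exact: closedU.
- by move=> r /AB[]; [left|right; left].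
- by case=> [Bt|/= ts]; [apply: nAB; exists t|exact: st].
- by exists s => //; split=> //; right.
Qed.

Section ThreeClosedPoints.
Variables x y z : X.
Hypotheses (cx : closed_points X x) (cy : closed_points X y)
  (cz : closed_points X z).
Hypotheses (xy : x <> y) (yz : y <> z) (zx : z <> x).

Lemma three_closed_points_girth : girth G = Some 3.
Proof.
have [u uE] := vertex_of_point cx cy xy.
have [v vE] := vertex_of_point cy cz yz.
have [w wE] := vertex_of_point cz cx zx.
by apply: (@girth_triangle _ u v w); apply/edgeP => t _;
  rewrite ?uE ?vE ?wE /= => ->.
Qed.

(** Two vertices never cover an irreducible set of closed points, so they miss a
    common one. Distance 2 is attained between the closed sets of [x] and of
    [x] together with [y], which is a vertex because it misses [z]. *)
Lemma closed_points_irreducible_diam : closed_points_irreducible X ->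
  diam G = Some 2.
Proof.
move=> irr; have [u uE] := vertex_of_point cx cy xy.
have [v vE] : exists v, vset v = [set x] `|` [set y].
  apply: (@vertex_of _ x z) => //; [exact: closedU|by left|].
  by case=> [/zx//|/esym/yz].
apply: (@diam_eq _ _ u v) => [a b|]; last first.
  apply: dist_ge2; last by apply: (not_edge cx); rewrite ?uE ?vE //; left.
  apply/eqP => uv; have : vset u y by rewrite uv vE; right.
  by rewrite uE => /esym.
have [t ct [nat nbt]] : exists2 t, closed_points X t & ~ vset a t /\ ~ vset b t.
  apply: contrapT => nt.
  have [||] := irr _ _ (@vset_closed a) (@vset_closed b).
  - move=> t ct; apply: contrapT => /not_orP ntab; by apply: nt; exists t.
  - by have [t ct nat] := vset_missed_point a => /(_ t ct).
  - by have [t ct nbt] := vset_missed_point b => /(_ t ct).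
exact: dist_le2_missed ct nat nbt.
Qed.

(** If two closed sets cover three points, one of them contains two of these. *)
Lemma closed_points_reducible_diam : ~ closed_points_irreducible X ->
  diam G = Some 3.
Proof.
move=> /existsNP[A /existsNP[B /not_implyP[clA /not_implyP[clB
  /not_implyP[AB /not_orP[nA nB]]]]]].
have [p cp nAp] : exists2 p, closed_points X p & ~ A p.
  by move/existsNP: nA => [p /not_implyP[]]; exists p.
have [q cq nBq] : exists2 q, closed_points X q & ~ B q.
  by move/existsNP: nB => [q /not_implyP[]]; exists q.
have BA : closed_points X `<=` B `|` A by rewrite setUC.
have := covering_diam_two_points clA clB AB _ _ _ _ _ cp nAp nB.
have := covering_diam_two_points clB clA BA _ _ _ _ _ cq nBq nA.
move=> dB dA; have [Ax|Bx] := AB x cx; have [Ay|By] := AB y cy;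
  have [Az|Bz] := AB z cz.
- exact: (dA x y).
- exact: (dA x y).
- exact: (dA z x).
- exact: (dB y z).
- exact: (dA y z).
- exact: (dB z x).
- exact: (dB x y).
- exact: (dB x y).
Qed.

End ThreeClosedPoints.
End ClosedPoints.

(** * Maximal ideals *)

Section MaximalIdeals.
Variable R : comPzRingType.
Implicit Types I J M P : set R.

Lemma ideal_one I : is_ideal I -> I 1%R -> I = setT.
Proof.
move=> [_ _ IM] I1; apply/seteqP; split=> // x _.
by rewrite -(GRing.mulr1 x); apply: IM.
Qed.

(** Zorn's lemma is applied to the sets [J] such that [I `|` J] is a proper
    ideal rather than to the proper ideals containing [I], so that the union of
    the empty chain is admissible. *)
Lemma maximal_exists I :
  is_ideal I -> ~ I 1%R -> exists2 M, is_maximal_ideal M & I `<=` M.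
Proof.
move=> Iid nI1; pose proper J := is_ideal (I `|` J) /\ ~ (I `|` J) 1%R.
have [|J [[Jid nJ1] Jmax]] := @Zorn_bigcup _ proper.
  move=> F Fproper Ftot; have [I0 ID IM] := Iid; split; last first.
    by case=> // -[J /Fproper[_ nJ1] J1]; apply: nJ1; right.
  split; first by left.
  - move=> x y [Ix|[J FJ Jx]] [Iy|[K FK Ky]].
    + by left; apply: ID.
    + have [[_ KD _] _] := Fproper _ FK.
      by case: (KD x y); [left|right|left|right; exists K].
    + have [[_ JD _] _] := Fproper _ FJ.
      by case: (JD x y); [right|left|left|right; exists J].
    + have [JK|KJ] := Ftot _ _ FJ FK.
        have [[_ KD _] _] := Fproper _ FK.
        by case: (KD x y); [right; apply: JK|right|left|right; exists K].
      have [[_ JD _] _] := Fproper _ FJ.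
      by case: (JD x y); [right|right; apply: KJ|left|right; exists J].
  - move=> a x [Ix|[J FJ Jx]]; first by left; apply: IM.
    have [[_ _ JM] _] := Fproper _ FJ.
    by case: (JM a x); [right|left|right; exists J].
exists (I `|` J); last exact: subsetUl.
split=> // [|K Kid IJK]; first by apply/eqP => IJT; apply: nJ1; rewrite IJT.
have [K1|nK1] := pselect (K 1%R); [by right; exact: ideal_one|left].
have IK : I `|` K = K.
  by apply/setUidPr; apply: subset_trans IJK; exact: subsetUl.
apply/seteqP; split; last by []; apply: contrapT => nKIJ.
apply: (Jmax K); last by rewrite /proper IK.
split; first by apply: subset_trans IJK; exact: subsetUr.
by move=> KJ; apply: nKIJ => x /KJ; right.
Qed.

Lemma maximal_prime M : is_maximal_ideal M -> is_prime_ideal M.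
Proof.
move=> [[M0 MD MM] MT Mmax]; split=> // x y Mxy.
have [|nMx] := pselect (M x); [by left|right].
pose J := [set z | exists2 m, M m & exists a, z = (m + a * x)%R].
have MJ : M `<=` J.
  by move=> m Mm; exists m => //; exists 0%R; rewrite GRing.mul0r GRing.addr0.
have [|JM|JT] := Mmax J _ MJ.
- split; first exact: MJ.
  + move=> _ _ [m Mm [a ->]] [n Mn [b ->]]; exists (m + n)%R; first exact: MD.
    by exists (a + b)%R; rewrite GRing.mulrDl GRing.addrACA.
  + move=> c _ [m Mm [a ->]]; exists (c * m)%R; first exact: MM.
    by exists (c * a)%R; rewrite GRing.mulrDr GRing.mulrA.
- case: nMx; rewrite -JM; exists 0%R => //.
  by exists 1%R; rewrite GRing.mul1r GRing.add0r.
- have [m Mm [a oneE]] : J 1%R by rewrite JT.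
  rewrite -(GRing.mul1r y) oneE GRing.mulrDl -GRing.mulrA.
  by apply: MD; [rewrite GRing.mulrC|]; apply: MM.
Qed.

Lemma prime_sub_maximal P :
  is_prime_ideal P -> exists2 M, is_maximal_ideal M & P `<=` M.
Proof.
move=> [Pid /eqP PT _]; apply: maximal_exists => // P1; apply: PT.
exact: ideal_one.
Qed.

(** Maximality can be tested against primes alone, which are the points of the
    spectrum. *)
Lemma is_maximalP P : is_prime_ideal P ->
  is_maximal_ideal P <-> forall Q, is_prime_ideal Q -> P `<=` Q -> Q = P.
Proof.
move=> Ppr; split=> [[_ _ Pmax] Q [Qid /eqP QT _] /(Pmax Q Qid)[]//|Pmax].
have [M Mmax PM] := prime_sub_maximal Ppr.
by rewrite -(Pmax M (maximal_prime Mmax) PM).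
Qed.

Lemma prime_set_inj : injective (@prime_set R).
Proof.
move=> [P Pp] [Q Qp] /= PQ; rewrite PQ in Pp *.
by rewrite (Prop_irrelevance Pp Qp).
Qed.

End MaximalIdeals.

(** * Spaces of primes whose specialization order is inclusion *)

(** [ideal_of] identifies the points of [X] with the primes of [R] so that the
    closure of a point consists of the larger primes. Both [Spec R] and
    [Alex R] have this property, and only the diameters for three or more
    maximal ideals depend on more than it. *)
Section Specialization.
Variables (R : comPzRingType) (X : topologicalType) (ideal_of : X -> set R).
Hypothesis closureE1 : forall p q : X,
  closure [set p] q <-> ideal_of p `<=` ideal_of q.
Hypothesis ideal_of_inj : injective ideal_of.
Hypothesis ideal_of_prime : range ideal_of = @is_prime_ideal R.

Local Notation G := (Gamma_sigma X).

Let ideal_ofP p : is_prime_ideal (ideal_of p).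
Proof. by rewrite -ideal_of_prime; exists p. Qed.

Let ideal_of_surj P : is_prime_ideal P -> exists p, ideal_of p = P.
Proof. by rewrite -ideal_of_prime => -[p _ <-]; exists p. Qed.

Lemma closed_pointE p : closed_points X p <-> Omega R (ideal_of p).
Proof.
rewrite /closed_points /Omega /= (is_maximalP (ideal_ofP p)); split.
  move=> clp _ /ideal_of_surj[q <-] /closureE1.
  by move/(closureS_closed clp (@subset_refl _ [set p])) => /= ->.
move=> pmax; suff <- : closure [set p] = [set p] by exact: closed_closure.
apply/seteqP; split; last exact: subset_closure.
by move=> q /closureE1/(pmax _ (ideal_ofP q))/ideal_of_inj.
Qed.

Lemma closed_has_closed_point (A : set X) :
  closed A -> A !=set0 -> exists2 x, closed_points X x & A x.
Proof.
move=> clA [p Ap]; have [M Mmax pM] := prime_sub_maximal (ideal_ofP p).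
have [q qE] := ideal_of_surj (maximal_prime Mmax); rewrite -{}qE in Mmax pM.
exists q; first exact/closed_pointE.
by apply: (closureS_closed clA) (proj2 (closureE1 p q) pM) => _ ->.
Qed.

Lemma OmegaE : Omega R = ideal_of @` closed_points X.
Proof.
apply/seteqP; split=> [M Mmax|_ [p /closed_pointE Mmax <-]//].
have [p pE] := ideal_of_surj (maximal_prime Mmax).
by exists p => //; apply/closed_pointE; rewrite pE.
Qed.

Lemma card_Omega : Omega R #= closed_points X.
Proof. by rewrite OmegaE; apply: inj_card_eq => p q _ _ /ideal_of_inj. Qed.

Lemma closed_points_set1 p : Omega R = [set ideal_of p] ->
  closed_points X = [set p].
Proof.
move=> OE; apply/seteqP; split=> [q /closed_pointE|_ -> /=].
  by rewrite OE => /= /ideal_of_inj.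
by apply/closed_pointE; rewrite OE.
Qed.

Lemma local_space : is_local R <-> exists x, closed_points X = [set x].
Proof.
split=> [[M OE]|[p cE]]; last first.
  by exists (ideal_of p); rewrite OmegaE cE image_set1.
have Mmax : Omega R M by rewrite OE.
move: OE; have [p <-] := ideal_of_surj (maximal_prime Mmax).
by move=> /closed_points_set1 cE; exists p.
Qed.

Lemma nonlocal_chromatic_clique : ~ is_local R ->
  chromatic_number_is G (Omega R) /\ clique_number_is G (Omega R).
Proof.
rewrite local_space => nloc.
have [K clK cK] := closed_points_clique closed_has_closed_point nloc.
apply: (@chromatic_clique_numbers _ _ _ K) => //.
  apply: colorable_card_le (colorable_closed_points closed_has_closed_point) _.
  by have /card_eqPle[] := card_Omega.
by rewrite (card_le_eql card_Omega).
Qed.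

Lemma local_no_vertex : is_local R -> [set: G] = set0.
Proof.
by move=> /local_space[x]; exact: (no_vertex closed_has_closed_point).
Qed.

Lemma two_maximal_ideals_graph (m1 m2 : set R) :
  m1 <> m2 -> Omega R = [set m1; m2] ->
  let nonmax_below :=
    forall p : X, ~ Omega R (ideal_of p) -> ideal_of p `<=` m1 `&` m2 in
  let separated := exists p1 p2 : X,
    [/\ ~ Omega R (ideal_of p1) /\ ~ Omega R (ideal_of p2),
        ideal_of p1 `<=` m1, ideal_of p2 `<=` m2,
        ~ (ideal_of p1 `<=` m2) & ~ (ideal_of p2 `<=` m1)] in
  [/\ nonmax_below -> diam G = Some 1, ~ nonmax_below -> diam G = Some 2,
      separated -> girth G = Some 4 & ~ separated -> girth G = None].
Proof.
move=> m12 OE below separated.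
have Om1 : Omega R m1 by rewrite OE; left.
have Om2 : Omega R m2 by rewrite OE; right.
have [x xE] := ideal_of_surj (maximal_prime Om1).
have [y yE] := ideal_of_surj (maximal_prime Om2).
have xy : x <> y by move=> xy; apply: m12; rewrite -xE xy.
have cE : closed_points X = [set x; y].
  apply/seteqP; split=> p.
    move=> /closed_pointE; rewrite OE -xE -yE.
    by case=> /ideal_of_inj->; [left|right].
  by case=> ->; apply/closed_pointE; rewrite OE -xE -yE; [left|right].
have closureE p q : closure [set p] q = (ideal_of p `<=` ideal_of q).
  exact/propext/closureE1.
have closed_pointsE : closed_points X = [set p | Omega R (ideal_of p)].
  by apply/funext => p; apply/propext/closed_pointE.
have belowE : below = forall p : X, ~ closed_points X p ->
    closure [set p] x /\ closure [set p] y.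
  by apply/propext; split=> h p; have := h p;
    rewrite closed_pointsE !closureE xE yE subsetI.
have separatedE : separated = exists p q : X,
    [/\ ~ closed_points X p /\ ~ closed_points X q,
        closure [set p] x, closure [set q] y,
        ~ closure [set p] y & ~ closure [set q] x].
  by apply/propext; split=> -[p [q h]]; exists p, q; move: h;
    rewrite closed_pointsE !closureE xE yE.
have := two_closed_points_graph closed_has_closed_point xy cE.
by rewrite /= -belowE -separatedE.
Qed.

Lemma three_maximal_ideals_points : `I_3 #<= Omega R ->
  exists x y z, [/\ closed_points X x, closed_points X y & closed_points X z] /\
    [/\ x <> y, y <> z & z <> x].
Proof.
rewrite (card_le_eqr card_Omega) => /card_leP[f].
have lt k (k3 : k < 3) : k \in (`I_3 : set nat) by apply/mem_set.
pose pt k k3 := f (SigSub (lt k k3)).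
have ptc k k3 : closed_points X (val (pt k k3)) by exact: set_valP.
have ptne k k3 l l3 : k != l -> val (pt k k3) <> val (pt l l3).
  move=> + /val_inj/(inj (mem_setT _) (mem_setT _))/(congr1 val) /=.
  by move=> /eqP.
by exists (val (@pt 0 isT)), (val (@pt 1 isT)), (val (@pt 2 isT)); split; split;
  try exact: ptc; exact: ptne.
Qed.

End Specialization.

(** * The Zariski and the Alexandrov topology *)

Section SpecAlex.
Variable R : comPzRingType.

Lemma range_prime_set : range (@prime_set R) = @is_prime_ideal R.
Proof.
apply/seteqP; split=> [_ [P _ <-]|P Pp]; first exact: Defs.primeP.
by exists (PrimeIdeal Pp).
Qed.

Lemma closure_Spec (P Q : Spec R) : closure [set P] Q <-> P `<=` Q.
Proof.
rewrite closureE; split=> [|PQ A [/closed_SpecE[I _ ->] PV]].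
  move=> /(_ [set S : Spec R | P `<=` S]); apply; split=> [|_ -> //].
  by apply/closed_SpecE; exists P => //; exact: prime_ideal.
by apply: subset_trans PQ; apply: (PV P).
Qed.

Lemma closure_Alex (P Q : Alex R) : closure [set P] Q <-> P `<=` Q.
Proof.
rewrite closureE; split=> [|PQ A [/closed_AlexE/alex_closedP Aup PA]].
  move=> /(_ [set S : Alex R | P `<=` S]); apply; split=> [|_ -> //].
  by apply/closed_AlexE/alex_closedP => P1 P2; exact: subset_trans.
exact: Aup (PA P _) PQ.
Qed.

Let closed_point_Spec :=
  closed_pointE closure_Spec (@prime_set_inj R) range_prime_set.
Let closed_point_Alex :=
  closed_pointE closure_Alex (@prime_set_inj R) range_prime_set.

(** A closed point and the set of all others are both closed, since any set of
    maximal ideals is stable under enlarging primes. *)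
Lemma Alex_closed_points_reducible (x y : Alex R) :
  closed_points (Alex R) x -> closed_points (Alex R) y -> x <> y ->
  ~ closed_points_irreducible (Alex R).
Proof.
move=> cx cy xy irr.
have [|||xall|/(_ x cx)[]] := irr [set x] (closed_points (Alex R) `\ x) => //.
- apply/closed_AlexE/alex_closedP => P Q [cP Px] PQ.
  suff -> : Q = P by [].
  have /closed_point_Alex/(is_maximalP (Defs.primeP P)) Pmax := cP.
  by apply: prime_set_inj; apply: Pmax => //; exact: Defs.primeP.
- by move=> z cz; have [->|zx] := pselect (z = x); [left|right].
- by have /esym := xall y cy.
- by move=> _; apply.
Qed.

(** If [x * y] lies in every maximal ideal, the closed sets of primes containing
    [x] and of primes containing [y] cover the maximal ideals. Conversely, if
    [V I] and [V J] cover them while neither does alone, elements of [I] and of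
    [J] outside the radical have their product in every maximal ideal. *)
Lemma Spec_irreducible_Jac : Omega R !=set0 ->
  closed_points_irreducible (Spec R) <-> is_prime_ideal (Jac R).
Proof.
move=> [M0 M0max]; have JacP x :
    Jac R x <-> forall P : Spec R, closed_points (Spec R) P -> prime_set P x.
  split=> [Jx P /closed_point_Spec|Jx M Mmax]; first exact: Jx.
  apply: (Jx (PrimeIdeal (maximal_prime Mmax))).
  exact/closed_point_Spec.
have Jid : is_ideal (Jac R) by apply: bigcap_ideal => M [].
split=> [irr|[_ _ Jpr] A B /closed_SpecE[I _ ->] /closed_SpecE[J _ ->] IJ].
  split=> //.
    apply/eqP => JT; have [_ /eqP M0T _] := M0max; apply: M0T.
    by apply/seteqP; split=> // x _; have : Jac R x by [rewrite JT]; apply.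
  move=> x y Jxy; pose Vx (z : R) := [set P : Spec R | prime_set P z].
  have clV z : closed (Vx z).
    apply/closed_SpecE; exists (ideal_gen [set z]).
      exact: ideal_gen_ideal.
    by rewrite V_ideal_gen; apply/seteqP; split=> P /=; [move=> Pz _ ->|apply].
  have [|cx|cy] := irr _ _ (@clV x) (@clV y).
  - by move=> P cP; apply: primeM; have /JacP := Jxy; apply.
  - by left; apply/JacP.
  - by right; apply/JacP.
apply: contrapT => /not_orP[nI nJ].
have notin (K : set R) : ~ closed_points (Spec R) `<=` V K ->
    exists2 x, K x & ~ Jac R x.
  move=> nK; apply: contrapT => KJ; apply: nK => P cP x Kx.
  by apply: contrapT => nPx; apply: KJ; exists x => // /JacP/(_ P cP).
have [x Ix nJx] := notin _ nI; have [y Jy nJy] := notin _ nJ.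
suff /Jpr[] : Jac R (x * y)%R by [].
apply/JacP => P cP; have [_ _ PM] := prime_ideal P.
by case: (IJ P cP) => [/(_ x Ix)|/(_ y Jy)]; [rewrite GRing.mulrC|]; apply: PM.
Qed.

End SpecAlex.

Theorem theorem7p3 (R : comPzRingType) :
  let G := Gamma_sigma (Spec R) in
  let H := Gamma_sigma (Alex R) in
  (* (1) *)
  (~ is_local R ->
     [/\ chromatic_number_is G (Omega R), chromatic_number_is H (Omega R),
         clique_number_is G (Omega R) & clique_number_is H (Omega R)]) /\
  (* (2) *)
  (is_local R -> [set: G] = set0 /\ [set: H] = set0) /\
  (* (3) *)
  (forall m1 m2 : set R, m1 <> m2 -> Omega R = [set m1; m2] ->
     let nonmax_below := forall p : Spec R, ~ Omega R p -> p `<=` m1 `&` m2 in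
     let separated := exists p1 p2 : Spec R,
       [/\ ~ Omega R p1 /\ ~ Omega R p2, p1 `<=` m1, p2 `<=` m2,
           ~ (p1 `<=` m2) & ~ (p2 `<=` m1)] in
     [/\ nonmax_below -> diam G = Some 1 /\ diam H = Some 1,
         ~ nonmax_below -> diam G = Some 2 /\ diam H = Some 2,
         separated -> girth G = Some 4 /\ girth H = Some 4 &
         ~ separated -> girth G = None /\ girth H = None]) /\
  (* (4) *)
  (`I_3 #<= Omega R -> [/\ diam H = Some 3, girth H = Some 3 & girth G = Some 3]) /\
  (* (5) *)
  (`I_3 #<= Omega R -> is_prime_ideal (Jac R) -> diam G = Some 2) /\
  (* (6) *)
  (`I_3 #<= Omega R -> ~ is_prime_ideal (Jac R) -> diam G = Some 3).
Proof.
move=> G H.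
have inj := @prime_set_inj R; have ran := range_prime_set R.
have cG := @closure_Spec R; have cH := @closure_Alex R.
have pG := closed_has_closed_point cG inj ran.
have pH := closed_has_closed_point cH inj ran.
have threeG := three_maximal_ideals_points cG inj ran.
have threeH := three_maximal_ideals_points cH inj ran.
split; [|split; [|split; [|split; [|split]]]].
- move=> nloc.
  have [chG clG] := nonlocal_chromatic_clique cG inj ran nloc.
  by have [chH clH] := nonlocal_chromatic_clique cH inj ran nloc.
- move=> loc; split; first exact: local_no_vertex cG inj ran loc.
  exact: local_no_vertex cH inj ran loc.
- move=> m1 m2 m12 OE below separated.
  have [dG1 dG2 gG1 gG2] := two_maximal_ideals_graph cG inj ran m12 OE.
  have [dH1 dH2 gH1 gH2] := two_maximal_ideals_graph cH inj ran m12 OE.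
  by split=> h; split; [exact: dG1|exact: dH1|exact: dG2|exact: dH2|
    exact: gG1|exact: gH1|exact: gG2|exact: gH2].
- move=> O3; have [x [y [z [[cx cy cz] [xy yz zx]]]]] := threeG O3.
  have [x' [y' [z' [[cx' cy' cz'] [xy' yz' zx']]]]] := threeH O3.
  split.
  + apply: (closed_points_reducible_diam pH cx' cy' cz' xy' yz' zx').
    exact: Alex_closed_points_reducible xy'.
  + exact (three_closed_points_girth pH cx' cy' cz' xy' yz' zx').
  + exact (three_closed_points_girth pG cx cy cz xy yz zx).
- move=> O3 Jpr; have [x [y [z [[cx cy cz] [xy yz zx]]]]] := threeG O3.
  apply: (closed_points_irreducible_diam pG cx cy cz xy yz zx).
  apply/Spec_irreducible_Jac => //; exists (prime_set x).
  exact/(closed_pointE cG inj ran).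
- move=> O3 nJpr; have [x [y [z [[cx cy cz] [xy yz zx]]]]] := threeG O3.
  apply: (closed_points_reducible_diam pG cx cy cz xy yz zx).
  move/Spec_irreducible_Jac => h; apply/nJpr/h; exists (prime_set x).
  exact/(closed_pointE cG inj ran).
Qed.
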